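(* Let $V\subset\mathbb{R}^n$ be a compact convex set with non-empty interior, and let $p>0$, $q>0$ be integers. (1) If $q$ is even, then $$\omega_p t^p\cdot W_{\partial(V\times0^q)}^{p}(t)=\omega_{p+q}t^{p+q}\cdot W_{\partial V}^{p+q}(t).$$ (2) If $q$ is odd, then $$\omega_p t^p\cdot W_{\partial(V\times0^q)}^{p}(t)=\omega_{p+q-1}t^{p+q-1}\cdot W_{\partial(V\times0^1)}^{p+q-1}(t).$$
   Context: $\omega_m=\pi^{m/2}/\Gamma(\frac m2+1)$ is the volume of the closed unit ball $B^m$ of $\mathbb{R}^m$. $V\times0^q\subset\mathbb{R}^n\times\mathbb{R}^q=\mathbb{R}^{n+q}$ is the product of $V$ with the origin of $\mathbb{R}^q$. For a compact convex set $K\subset\mathbb{R}^m$ (possibly with empty interior), let $s_k^{\mathbb{R}^m}(K)$ be the coefficients of its Steiner polynomial: $\mathrm{Vol}_m(K+tB^m)=\sum_{k=0}^m s_k^{\mathbb{R}^m}(K)t^k$ for $t\ge0$. The Weyl coefficients of $\partial K$ are by definition $w_{2l}(\partial K)=2^l\frac{\Gamma(l+\frac12+1)}{\Gamma(\frac12+1)}s_{2l+1}^{\mathbb{R}^m}(K)$ for integers $l\ge0$ with $2l+1\le m$, and the Weyl polynomial of index $p$ is $W_{\partial K}^{p}(t)=\sum_{l}\frac{2^{-l}\Gamma(\frac p2+1)}{\Gamma(\frac p2+l+1)}w_{2l}(\partial K)t^{2l}$, summed over the same $l$. Here $\partial V$ is taken with $V\subset\mathbb{R}^n$, $\partial(V\times0^q)$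 with $V\times0^q\subset\mathbb{R}^{n+q}$, and $\partial(V\times0^1)$ with $V\times0^1\subset\mathbb{R}^{n+1}$. *)

(* Defs.v *)
From HB Require Import structures.
From mathcomp Require Import all_boot all_order all_algebra.
From mathcomp Require Import all_classical all_reals all_analysis.

Set Implicit Arguments.
Unset Strict Implicit.
Unset Printing Implicit Defensive.

Import Order.TTheory GRing.Theory Num.Theory.
Import numFieldNormedType.Exports.

Local Open Scope classical_set_scope.
Local Open Scope ring_scope.

Section LebesgueTuple.
Variable R : realType.
Local Notation T := (measurableTypeR R).

Definition consp m (x : T * m.-tuple T) : m.+1.-tuple T :=
  [the m.+1.-tuple T of x.1 :: x.2].

Lemma measurable_consp m : measurable_fun [set: T * m.-tuple T] (@consp m).
Proof. exact: measurable_cons. Qed.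

Lemma consp_preimage_measurable m (A : set (m.+1.-tuple T)) :
  measurable A -> measurable (@consp m @^-1` A).
Proof. by move=> mA; rewrite -[X in measurable X]setTI; apply: measurable_consp. Qed.

Definition unconsp m (u : m.+1.-tuple T) : T * m.-tuple T :=
  (thead u, [tuple of behead u]).

Lemma unconspK m : cancel (@unconsp m) (@consp m).
Proof. by move=> u; rewrite [RHS]tuple_eta; apply: val_inj. Qed.

Lemma conspK m : cancel (@consp m) (@unconsp m).
Proof. by move=> [x u]; rewrite /unconsp /= theadE; congr pair; apply: val_inj. Qed.

Lemma measurable_unconsp m : measurable_fun [set: m.+1.-tuple T] (@unconsp m).
Proof.
apply: measurable_fun_pair; first exact: measurable_tnth.
exact: measurable_behead.
Qed.

Section Step.
Local Open Scope ereal_scope.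
Variables (m : nat) (mu : {sigma_finite_measure set m.-tuple T -> \bar R}).

Definition lebesgue_step : set (m.+1.-tuple T) -> \bar R :=
  pushforward (lebesgue_measure \x mu) (@consp m).

Let step0 : lebesgue_step set0 = 0.
Proof. by rewrite /lebesgue_step /pushforward preimage_set0 measure0. Qed.

Let step_ge0 A : 0 <= lebesgue_step A.
Proof. by rewrite /lebesgue_step /pushforward; exact: measure_ge0. Qed.

Let step_sigma_additive : semi_sigma_additive lebesgue_step.
Proof.
move=> F mF tF mUF; rewrite /lebesgue_step /pushforward preimage_bigcup.
apply: measure_semi_sigma_additive.
- by move=> n; exact: consp_preimage_measurable.
- apply/trivIsetP => /= i j _ _ ij; rewrite -preimage_setI.
  by move/trivIsetP : tF => /(_ _ _ _ _ ij) ->//; rewrite preimage_set0.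
- by rewrite -preimage_bigcup; exact: consp_preimage_measurable.
Qed.

HB.instance Definition _ := isMeasure.Build _ _ _ lebesgue_step
  step0 step_ge0 step_sigma_additive.

Let step_sigma_finite : sigma_finite setT lebesgue_step.
Proof.
have /sigma_finiteP[F [FT ndF Foo]] := sigma_finiteT (@lebesgue_measure R).
have /sigma_finiteP[G [GT ndG Goo]] := sigma_finiteT mu.
exists (fun i => @unconsp m @^-1` (F i `*` G i)).
  rewrite -preimage_bigcup (_ : \bigcup_i _ = setT) ?preimage_setT//.
  rewrite -setXTT FT GT predeqE => -[x y]; split.
    by move=> [n _ []/= ? ?]; split; exists n.
  move=> [/= [n _ Fnx] [k _ Gky]]; exists (maxn n k) => //; split.
  - by move: x Fnx; exact/subsetPset/ndF/leq_maxl.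
  - by move: y Gky; exact/subsetPset/ndG/leq_maxr.
move=> i; have [mF Fi] := Foo i; have [mG Gi] := Goo i; split.
  rewrite -[X in measurable X]setTI; apply: measurable_unconsp => //.
  exact: measurableX.
rewrite /lebesgue_step /pushforward -comp_preimage.
rewrite (_ : _ \o _ = idfun); last by rewrite funeqE => x /=; rewrite conspK.
by rewrite preimage_id product_measure1E// lte_mul_pinfty// ge0_fin_numE.
Qed.

HB.instance Definition _ := Measure_isSigmaFinite.Build _ _ _ lebesgue_step
  step_sigma_finite.
End Step.

(* Iterated product measure; it lives on tuples because the library puts a
   sigma-algebra on m.-tuple T but not on 'rV[R]_m. *)
Fixpoint lebesgue_tuple m : {sigma_finite_measure set m.-tuple T -> \bar R} :=
  match m with
  | 0 => [the {sigma_finite_measure set _ -> \bar R} of \d_ [tuple]]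
  | m'.+1 => [the {sigma_finite_measure set _ -> \bar R} of
              lebesgue_step (lebesgue_tuple m')]
  end.

Lemma lebesgue_tuple_box m (A : 'I_m -> set T) :
  (forall i, measurable (A i)) ->
  (lebesgue_tuple m [set u | forall i, A i (tnth u i)] =
   \prod_(i < m) lebesgue_measure (A i))%E.
Proof.
elim: m A => [|m IH] A mA.
  rewrite big_ord0 /= diracE mem_set//=; by case.
rewrite big_ord_recl -(IH (fun i => A (lift ord0 i)))//= /lebesgue_step /pushforward.
rewrite -product_measure1E//; last first.
  rewrite (_ : [set _ | _] = \bigcap_(i in [set: 'I_m]) (fun u => tnth u i) @^-1` (A (lift ord0 i))).
    apply: fin_bigcap_measurable => [|i _]; first exact: finite_finset.
    by rewrite -[X in measurable X]setTI; apply: measurable_tnth.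
  apply/seteqP; split => u /= H i; first by move=> _; exact: (H i).
  exact: (H i).
congr product_measure1; apply/seteqP; split => -[x u] /=.
  by move=> H; split; [have := H ord0; rewrite tnth0| move=> i; have := H (lift ord0 i); rewrite tnthS].
by move=> [Hx Hu] i; case: (unliftP ord0 i) => [j ->|->]; rewrite ?tnthS ?tnth0.
Qed.

End LebesgueTuple.

Section Volume.
Variable R : realType.

Definition vol m (A : set 'rV[R]_m) : \bar R :=
  @lebesgue_tuple R m [set u | A (\row_i tnth u i)].

(* The norm that MathComp-Analysis puts on 'rV[R]_m is the sup norm, hence the
   explicit Euclidean ball. *)
Definition unit_ball m : set 'rV[R]_m :=
  [set x | \sum_(i < m) x ord0 i ^+ 2 <= 1].

(* K + t B^m *)
Definition parallel_set m (K : set 'rV[R]_m) (t : R) : set 'rV[R]_m :=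
  [set x + t *: b | x in K & b in @unit_ball m].

Definition is_steiner_poly m (K : set 'rV[R]_m) (P : {poly R}) : Prop :=
  (size P <= m.+1)%N /\
  forall t : R, 0 <= t -> vol (parallel_set K t) = (P.[t])%:E.

(* There is at most one such P (a polynomial is determined by its values on
   t >= 0), and Steiner's formula provides it when K is compact and convex. *)
Definition steiner_poly m (K : set 'rV[R]_m) : {poly R} :=
  xget 0 [set P | is_steiner_poly K P].

Definition steiner_coef m (K : set 'rV[R]_m) (k : nat) : R :=
  (steiner_poly K)`_k.

Definition Gamma (x : R) : R :=
  \int[lebesgue_measure]_(t in `]0, +oo[) (t `^ (x - 1) * expR (- t)).

Definition omega (m : nat) : R :=
  pi `^ (m%:R / 2) / Gamma (m%:R / 2 + 1).

(* weyl_coef K l is w_{2l}(dK) and weyl_poly K p is W^p_{dK}: both are indexed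
   by the body K, and depend on the dimension m of the ambient space. *)
Definition weyl_coef m (K : set 'rV[R]_m) (l : nat) : R :=
  2 ^+ l * (Gamma (l%:R + 2^-1 + 1) / Gamma (2^-1 + 1))
    * steiner_coef K (2 * l).+1.

(* The bound l < m is implied by 2l + 1 <= m; it only makes the range finite. *)
Definition weyl_poly m (K : set 'rV[R]_m) (p : nat) : {poly R} :=
  \sum_(l < m | ((2 * l).+1 <= m)%N)
    (2 ^- l * Gamma (p%:R / 2 + 1) / Gamma (p%:R / 2 + l%:R + 1)
       * weyl_coef K l) *: 'X^(2 * l).

(* V x 0^q *)
Definition prod0 n (q : nat) (V : set 'rV[R]_n) : set 'rV[R]_(n + q) :=
  [set row_mx x (0 : 'rV[R]_q) | x in V].

End Volume.

Arguments prod0 {R n} q V.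

(* Main.v *)
Require Import Defs.
From HB Require Import structures.
From mathcomp Require Import all_boot all_order all_algebra.
From mathcomp Require Import all_classical all_reals all_analysis.
From mathcomp Require Import measurable_realfun.
From mathcomp Require Import ring lra zify.
Set Implicit Arguments.
Unset Strict Implicit.
Unset Printing Implicit Defensive.
Import Order.TTheory GRing.Theory Num.Theory.
Import numFieldNormedType.Exports.
Local Open Scope classical_set_scope.
Local Open Scope ring_scope.

(* Adding two flat dimensions is an elementary and reversible operation on
   Steiner polynomials: integrating over the two new coordinates in polar form,
     Vol(K x 0^2 + t B) = pi * \int_0^(t^2) Vol(K + sqrt w B) dw,
   so K has the Steiner polynomial P if and only if K x 0^2 has the polynomial
   2 pi \int_0^t s P(s) ds; hence s_(k+2)(K x 0^2) = 2 pi / (k+2) * s_k(K) and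
   s_0 = s_1 = 0 for K x 0^2. Comparing coefficients through
   Gamma(x + 1) = x Gamma(x), this is the identity of the theorem for q = 2, and
   the general case follows by iteration, starting from V when q is even and
   from V x 0^1 when q is odd. Steiner's formula itself is never used: if one of
   the two polynomials does not exist, neither does the other, and both
   steiner_poly are 0. *)

(** * Radial integration in the plane *)

(** The derivative is asked for on the open interval only, which admits antiderivatives built from
    the square root on intervals starting at 0; the case [a = b] is included for radius 0. *)
Lemma integral_is_derive (R : realType) (f F : R -> R) (a b : R) : a <= b ->
  continuous f -> continuous F ->
  {in `]a, b[, forall x : R, is_derive x (1 : R) F (f x)} ->
  (\int[lebesgue_measure]_(x in `[a, b]) (f x)%:E = (F b - F a)%:E)%E.
Proof.
rewrite le_eqVlt => /predU1P[<-|ab] cf cF dF.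
  by rewrite set_itv1 integral_set1 subrr.
rewrite (@continuous_FTC2 _ f F)//.
- exact: continuous_subspaceT.
- split; [|exact: (cvg_at_right_filter (cF _))|exact: (cvg_at_left_filter (cF _))].
  by move=> x xab; have [] := dF x xab.
- by move=> x xab; rewrite derive1E; have [] := dF x xab.
Qed.

(** Substituting [s * sin x] turns the integrand into [2 * s^2 * cos^2 x], which has the
    antiderivative [H] below. *)
Lemma integral_semicircle (R : realType) (s : R) : 0 <= s ->
  (\int[lebesgue_measure]_(x in `[(- s)%R, s]) (2 * Num.sqrt (s ^+ 2 - x ^+ 2))%R%:E =
   (pi * s ^+ 2)%R%:E)%E.
Proof.
rewrite le_eqVlt => /predU1P[<-|s0].
  by rewrite oppr0 set_itv1 integral_set1 expr0n mulr0.
pose F (x : R) : R := s * sin x; pose G (x : R) : R := 2 * Num.sqrt (s ^+ 2 - x ^+ 2).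
have pi2 : - (pi / 2) <= pi / 2 :> R.
  by rewrite ge0_cp// divr_ge0// pi_ge0.
have dF x : is_derive x (1 : R) F (s * cos x) by apply: is_deriveZ.
have dFE : (F^`()%classic) = fun x => s * cos x.
  by apply/funext => x; rewrite derive1E; have [] := dF x.
have cdF : continuous ((F^`()%classic)).
  by rewrite dFE => x; apply: cvgM; [exact: cvg_cst|exact: continuous_cos].
have cF : continuous F.
  by move=> x; apply: cvgM; [exact: cvg_cst|exact: continuous_sin].
have cG : continuous G.
  have cq : continuous (fun x : R => s ^+ 2 - x ^+ 2).
    by move=> x; apply: cvgB; [exact: cvg_cst|exact: exprn_continuous].
  move=> x; apply: cvgM; first exact: cvg_cst.
  exact: (continuous_comp (cq x) (@sqrt_continuous _ _)).
have FpiN : F (- (pi / 2)) = - s by rewrite /F sinN sin_pihalf mulrN1.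
have Fpi : F (pi / 2) = s by rewrite /F sin_pihalf mulr1.
have := @integration_by_substitution_increasing R F G _ _ pi2.
rewrite Fpi FpiN => ->; last 6 first.
- move=> x y xpi ypi xy; rewrite /F ltr_pM2l// ltr_sin//.
- by move=> x _; exact: cdF.
- apply/cvg_ex; exists (F^`()%classic (- (pi / 2))).
  exact: (cvg_at_right_filter (cdF _)).
- apply/cvg_ex; exists (F^`()%classic (pi / 2)).
  exact: (cvg_at_left_filter (cdF _)).
- split; [|exact: (cvg_at_right_filter (cF _))|exact: (cvg_at_left_filter (cF _))].
  by move=> x _; have [] := dF x.
- exact: continuous_subspaceT.
pose H (x : R) : R := s ^+ 2 * (x + sin x * cos x).
have -> : pi * s ^+ 2 = H (pi / 2) - H (- (pi / 2)).
  by rewrite /H cosN sinN cos_pihalf; field.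
rewrite -(@integral_is_derive _ (fun x => s ^+ 2 * (2 * cos x ^+ 2)))//.
- apply: eq_integral => x; rewrite inE/= in_itv/= => xpi; congr EFin.
  transitivity (G (F x) * F^`()%classic x) => //.
  rewrite dFE /G /F exprMn -[X in X - _]mulr1 -mulrBr -cos2sin2.
  rewrite sqrtrM ?sqr_ge0// !sqrtr_sqr gtr0_norm// ger0_norm ?cos_ge0_pihalf//.
  by rewrite expr2; ring.
- move=> x; apply: cvgM; first exact: cvg_cst.
  apply: cvgM; first exact: cvg_cst.
  exact: (continuous_comp (@continuous_cos R x) (@exprn_continuous R 2 _)).
- move=> x; apply: cvgM; first exact: cvg_cst.
  by apply: cvgD => //; apply: cvgM; [exact: continuous_sin|exact: continuous_cos].
- move=> x _; rewrite /H.
  have -> : s ^+ 2 * (2 * cos x ^+ 2) =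
      s ^+ 2 * (1 + (sin x * (- sin x) + cos x * cos x)).
    have /(canRL (addrK _)) c2 := cos2Dsin2 x.
    by rewrite -!expr2 mulrN -expr2 !c2; ring.
  exact: is_deriveZ.
Qed.

Section radial.
Variable R : realType.
Local Notation T := (measurableTypeR R).
Local Notation mu := (@lebesgue_measure R).

Definition sqnorm2 (z : T * T) : R := z.1 ^+ 2 + z.2 ^+ 2.

Definition open_disk (r : R) : set (T * T) := [set z | sqnorm2 z < r].

Lemma measurable_sqnorm2 : measurable_fun setT sqnorm2.
Proof.
by apply: measurable_funD; apply: measurable_funX.
Qed.

Lemma open_disk_area (r : R) :
  ((mu \x mu) (open_disk r) = (pi * Num.max r 0)%R%:E)%E.
Proof.
(* Here [r] is the squared radius. As [Num.sqrt] is 0 on negative numbers, the formula also covers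
   the empty sections. *)
have secE x : mu (xsection (open_disk r) x) = (2 * Num.sqrt (r - x ^+ 2))%:E.
  rewrite (_ : xsection _ _ = `]- Num.sqrt (r - x ^+ 2), Num.sqrt (r - x ^+ 2)[%classic).
    rewrite lebesgue_measure_itv/= lte_fin; case: ifPn => [_|].
      by rewrite -EFinD; congr EFin; ring.
    rewrite -leNgt=> s0.
    have -> : Num.sqrt (r - x ^+ 2) = 0 by apply/eqP; rewrite eq_le sqrtr_ge0; lra.
    by rewrite mulr0.
  apply/seteqP; split => y; rewrite /xsection/= inE/= in_itv/= -ltr_norml -sqrtr_sqr.
    rewrite /open_disk/sqnorm2/= => xyr; have y0 := sqr_ge0 y.
    by rewrite ltr_sqrt; lra.
  rewrite /open_disk/sqnorm2/= => xyr.
  have s0 : 0 < r - x ^+ 2 by rewrite -sqrtr_gt0 (le_lt_trans _ xyr)// sqrtr_ge0.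
  by move: xyr; rewrite ltr_sqrt//; lra.
rewrite /product_measure1; under eq_integral do rewrite /= secE.
have [r0|r0] := leP r 0.
  rewrite mulr0 integral0_eq// => x _.
  have -> : Num.sqrt (r - x ^+ 2) = 0.
    by apply/eqP; rewrite sqrtr_eq0; have := sqr_ge0 x; lra.
  by rewrite mulr0.
rewrite -[r in RHS]sqr_sqrtr 1?ltW// -integral_semicircle ?sqrtr_ge0//.
rewrite [RHS]integral_mkcond; apply: eq_integral => x _.
rewrite patchE sqr_sqrtr 1?ltW//; case: ifPn => //.
rewrite notin_setE/= in_itv/= -ler_norml => /negP; rewrite -ltNge => xr.
have -> : Num.sqrt (r - x ^+ 2) = 0; last by rewrite mulr0.
apply/eqP; rewrite sqrtr_eq0 subr_le0 -(sqr_sqrtr (ltW r0)).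
by rewrite -[leRHS]real_normK ?num_real// lerXn2r// ?nnegrE ?sqrtr_ge0// ltW.
Qed.

Lemma measurable_open_disk (r : R) : measurable (open_disk r).
Proof.
rewrite -[X in measurable X]setTI.
have /= := measurable_sqnorm2 measurableT (measurable_itv `]-oo, r[).
by congr measurable; apply/seteqP; split => z /=; rewrite in_itv.
Qed.

(** The set is an annulus, closed inside and open outside, hence a difference of two open disks; the
    maxima account for disks that are empty. *)
Lemma sqnorm2_itv (c a b : R) : a <= b ->
  ((mu \x mu) [set z | (a < c - sqnorm2 z <= b)%R] =
   (pi * (Num.max (c - a) 0 - Num.max (c - b) 0))%R%:E)%E.
Proof.
move=> ab.
have -> : [set z | (a < c - sqnorm2 z <= b)%R] = open_disk (c - a) `\` open_disk (c - b).
  apply/seteqP; split => z; rewrite /open_disk/=.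
    by move=> /andP[az zb]; split; [lra|apply/negP; rewrite -leNgt; lra].
  by move=> [az /negP]; rewrite -leNgt => zb; apply/andP; split; lra.
have sub : open_disk (c - b) `<=` open_disk (c - a).
  by move=> z; rewrite /open_disk/=; lra.
rewrite measureD.
- rewrite setIidr// [X in (X - _)%E]open_disk_area.
  by rewrite [X in (_ - X)%E]open_disk_area -EFinB -mulrBr.
- exact: measurable_open_disk.
- exact: measurable_open_disk.
- by rewrite [ltLHS]open_disk_area ltry.
Qed.

(** The area of a disk is linear in its squared radius, so the squared radius carries the constant
    density [pi]. The two measures are compared on half-open intervals, which determine Lebesgue
    measure. *)
Lemma sqnorm2_preimage (c : R) (A : set T) : measurable A -> A `<=` `[0, c] ->
  ((mu \x mu) [set z | A (c - sqnorm2 z)%R] = pi%:E * mu A)%E.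
Proof.
pose phi (z : T * T) : T := c - sqnorm2 z.
have mphi : measurable_fun setT phi.
  by apply: measurable_funB => //; exact: measurable_sqnorm2.
have [pf pfE] : exists pf : {measure set T -> \bar R}, forall A,
    pf A = (mu \x mu)%E (phi @^-1` A).
  by unshelve eexists (pushforward (mu \x mu)%E phi); [exact: mphi|].
have pi0 : 0 <= pi^-1 :> R by rewrite invr_ge0 pi_ge0.
(* the image measure vanishes beyond c, so it is completed there before
   appealing to the uniqueness of Lebesgue measure on the whole line *)
pose m := measure_add (mscale (NngNum pi0) pf) (mrestr mu (measurable_itv `]c, +oo[)).
have mE X : m X = (pi^-1%:E * (mu \x mu) (phi @^-1` X) + mu (X `&` `]c, +oo[))%E.
  by rewrite /m measure_addE -pfE.
move=> mA Ac.
have muE : forall X, ocitv X -> mu X = m X.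
  move=> _ [[a b] /= _ <-]; have [ba|ab] := leP b a.
    by rewrite set_itv_ge ?measure0// -leNgt.
  rewrite mE.
  have -> : phi @^-1` `]a, b] = [set z | a < c - sqnorm2 z <= b].
    by apply/seteqP; split => z /=; rewrite in_itv.
  rewrite sqnorm2_itv 1?ltW// -EFinM mulrA mulVf ?gt_eqF ?pi_gt0// mul1r.
  have -> : `]a, b] `&` `]c, +oo[ = `](Num.max a c), b]%classic.
    apply/seteqP; split => z /=; rewrite !in_itv/= andbT gt_max.
      by move=> [/andP[-> ->] ->].
    by move=> /andP[/andP[-> ->] ->].
  rewrite !lebesgue_measure_itv/= !lte_fin ab.
  have [bc|cb] := leP b (Num.max a c).
    have bc' : b <= c by move: bc; rewrite le_max leNgt ab.
    rewrite adde0 -EFinB; congr EFin.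
    by rewrite !(elimT max_idPl) ?subr_ge0//; [ring|apply: le_trans bc'; exact: ltW].
  rewrite -!EFinB -EFinD; congr EFin.
  have cb' : c < b by move: cb; rewrite gt_max => /andP[].
  rewrite (elimT (@max_idPr _ _ (c - b) 0)) ?subr_le0 1?ltW//.
  by have [ac|ca] := leP a c; rewrite /Num.max; case: ifPn; rewrite -?leNgt; lra.
have -> : mu A = m A by exact: (lebesgue_measure_unique muE).
rewrite mE.
have -> : A `&` `]c, +oo[ = set0.
  apply/seteqP; split => // z [/Ac/=]; rewrite !in_itv/= andbT => /andP[_ zc].
  by rewrite ltNge zc.
by rewrite measure0 adde0 muleA -EFinM divff ?gt_eqF ?pi_gt0// mul1e.
Qed.

Lemma integral_sqnorm2 (c : R) (h : T -> \bar R) : measurable_fun setT h ->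
  (forall w, 0 <= h w)%E -> (forall w, w < 0 -> h w = 0%E) ->
  (\int[mu \x mu]_z h (c - sqnorm2 z)%R = pi%:E * \int[mu]_(w in `[0%R, c]) h w)%E.
Proof.
move=> mh h0 hN.
pose phi (z : T * T) : T := c - sqnorm2 z.
have mphi : measurable_fun setT phi.
  by apply: measurable_funB => //; exact: measurable_sqnorm2.
(* Nothing is lost by this restriction: [h] vanishes below 0, and [phi] never exceeds [c]. *)
transitivity (\int[mu \x mu]_(z in phi @^-1` `[0%R, c]) (h \o phi) z)%E.
  rewrite [RHS]integral_mkcond; apply: eq_integral => z _.
  rewrite patchE; case: ifPn => //; rewrite notin_setE/= in_itv/= => /negP.
  rewrite negb_and -!ltNge => /orP[/hN//|].
  rewrite /phi /sqnorm2 => cz; exfalso; move: cz.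
  by have := sqr_ge0 z.1; have := sqr_ge0 z.2; lra.
have pi0 : 0 <= pi :> R by exact: pi_ge0.
have mhD : measurable_fun `[0, c] h by exact: measurable_funS mh.
rewrite -(ge0_integral_mscale mu _ (NngNum pi0))//.
rewrite -(ge0_integral_pushforward mphi (mu \x mu)%E)//.
apply: eq_measure_integral => //= A mA Ac.
exact: sqnorm2_preimage.
Qed.

End radial.

(** * The functional equation of Gamma *)

Lemma is_derive_expRN (R : realType) (t : R) :
  is_derive t (1 : R) (fun t : R => expR (- t)) (- expR (- t)).
Proof.
have := @is_derive1_comp R expR -%R t (expR (- t)) (-1) _ _.
by rewrite mulrN1; apply.
Qed.

(** A single term of the exponential series, that of degree [N.+1], already bounds [expR t] from
    below. This makes the boundary term of the integration by parts vanish at infinity. *)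
Lemma powR_expRN_le (R : realType) (x t : R) (N : nat) : x <= N%:R -> 1 <= t ->
  t `^ x * expR (- t) <= N.+1`!%:R / t.
Proof.
move=> xN t1; have t0 : 0 < t by apply: lt_le_trans t1.
rewrite expRN ler_pdivlMr// mulrAC ler_pdivrMr ?expR_gt0//.
have tx : t * t `^ x <= t ^+ N.+1.
  by rewrite exprS ler_pM2l// -(powR_mulrn N (ltW t0)) ler_powR.
have f0 : 0 < N.+1`!%:R :> R by rewrite ltr0n fact_gt0.
have et : t ^+ N.+1 / N.+1`!%:R <= expR t.
  by apply: le_trans (expR_ge1Dxn N (ltW t0)); rewrite lerDr.
by rewrite mulrC (le_trans tx)// mulrC -ler_pdivrMr.
Qed.

(** Integration by parts on an interval away from 0, where the power function is differentiable; the
    limits [a] to 0 and [b] to infinity are taken in [GammaD1]. *)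
Lemma integral_powR_expRN (R : realType) (x a b : R) : 0 <= x -> 0 < a -> a < b ->
  (\int[lebesgue_measure]_(t in `[a, b]) (t `^ x * expR (- t))%R%:E =
   (a `^ x * expR (- a) - b `^ x * expR (- b))%R%:E +
   \int[lebesgue_measure]_(t in `[a, b]) (x * (t `^ (x - 1) * expR (- t)))%R%:E)%E.
Proof.
move=> x0 a0 ab; have pos t : t \in `[a, b] -> 0 < t.
  by rewrite in_itv/= => /andP[at_ _]; exact: lt_le_trans at_.
have poso t : t \in `]a, b[ -> 0 < t.
  by rewrite in_itv/= => /andP[at_ _]; exact: lt_trans at_.
have cpow t : 0 < t -> {for t, continuous (fun t => t `^ x)}.
  move=> t0; apply: differentiable_continuous; apply/derivable1_diffP.
  by have [] := is_derive1_powR x t0.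
have cexp : continuous (fun t : R => expR (- t)).
  by move=> t; apply: (continuous_comp (@oppr_continuous R R t)); exact: continuous_expR.
have cexpN : continuous (fun t : R => - expR (- t)).
  by move=> t; apply: cvgN; exact: cexp.
rewrite (@integration_by_parts _ (fun t => t `^ x) (fun t => - expR (- t))
  (fun t => x * t `^ (x - 1)) (fun t => expR (- t)) a b)//.
- rewrite [X in (_ - X)%E](_ : _ = - \int[lebesgue_measure]_(t in `[a, b])
      (x * (t `^ (x - 1) * expR (- t)))%R%:E)%E; last first.
    under eq_integral do rewrite mulrN -mulrA EFinN.
    rewrite integral_ge0N// => t _.
    by rewrite lee_fin !mulr_ge0// ?powR_ge0 ?expR_ge0.
  by rewrite oppeK; congr (_%:E + _)%E; rewrite !mulrN opprK addrC.
- apply: derivable_within_continuous => t tab; apply: derivableM => //.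
  by have [] := is_derive1_powR (x - 1) (pos t tab).
- split.
  + by move=> t tab; have [] := is_derive1_powR x (poso t tab).
  + exact: (cvg_at_right_filter (cpow _ a0)).
  + exact: (cvg_at_left_filter (cpow _ (lt_trans a0 ab))).
- by move=> t tab; rewrite derive1E; have [] := is_derive1_powR x (poso t tab).
- exact: continuous_subspaceT.
- split; [|exact: (cvg_at_right_filter (cexpN _))|exact: (cvg_at_left_filter (cexpN _))].
  by move=> t _; apply: derivableN; have [] := is_derive_expRN t.
- move=> t _; rewrite derive1E deriveN; last by have [] := is_derive_expRN t.
  by have [_ ->] := is_derive_expRN t; rewrite opprK.
Qed.

(** Monotone convergence along an exhaustion of the half-line; the index [n.+2] keeps the interval
    nondegenerate even for [n = 0]. *)
Lemma cvg_integral0y (R : realType) (f : R -> R) :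
  measurable_fun setT f -> (forall t, 0 <= f t) ->
  (\int[lebesgue_measure]_(t in `[(n.+2%:R^-1)%R, (n.+1%:R)%R]) (f t)%:E)%E
    @[n --> \oo] --> (\int[lebesgue_measure]_(t in `]0%R, +oo[) (f t)%:E)%E.
Proof.
move=> mf f0; pose F n := `[n.+2%:R^-1, n.+1%:R : R]%classic.
have -> : `]0%R, +oo[%classic = \bigcup_n F n.
  apply/seteqP; split => [t|t [n _]]; rewrite /F/= !in_itv/=; last first.
    by move=> /andP[nt _]; rewrite andbT; apply: lt_le_trans nt; rewrite invr_gt0.
  rewrite andbT => t0; exists (maxn (Num.truncn t^-1) (Num.truncn t)) => //=.
  set n := maxn _ _; rewrite in_itv/=; apply/andP; split.
    rewrite -[leRHS]invrK lef_pV2 ?posrE ?invr_gt0// (le_trans (ltW (truncnS_gt _)))//.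
    by rewrite ler_nat !ltnS (leq_trans (leq_maxl _ (Num.truncn t))).
  by rewrite (le_trans (ltW (truncnS_gt _)))// ler_nat ltnS leq_maxr.
apply: ge0_nondecreasing_set_cvg_integral.
- move=> i j ij; apply/subsetPset => t; rewrite /F/= !in_itv/= => /andP[it ti].
  apply/andP; split; last by rewrite (le_trans ti)// ler_nat ltnS.
  by apply: le_trans it; rewrite lef_pV2 ?posrE// ler_nat !ltnS.
- by move=> i; exact: measurable_itv.
- by move=> i; apply/measurable_EFinP; exact: measurable_funS mf.
- by move=> i t _; rewrite lee_fin.
Qed.

Lemma GammaD1 (R : realType) (x : R) : 1 <= x -> Gamma (x + 1) = x * Gamma x.
Proof.
move=> x1; have x0 : 0 < x by apply: lt_le_trans x1.
pose f (y t : R) := t `^ y * expR (- t).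
have mf y : measurable_fun setT (f y).
  apply: measurable_funM; first exact: measurable_powR.
  by apply: measurableT_comp => //; exact: measurable_expR.
have f0 y t : 0 <= f y t by rewrite mulr_ge0 ?powR_ge0 ?expR_ge0.
pose I y := (\int[lebesgue_measure]_(t in `]0%R, +oo[) (f y t)%:E)%E.
(* The identity is proved for extended-real integrals, so finiteness is never discussed: if
   [I (x - 1)] were infinite, so would be [I x], and both real values would be 0. *)
suff IE : I x = (x%:E * I (x - 1)%R)%E.
  rewrite /Gamma /Rintegral addrK -/(I x) -/(I (x - 1)%R) IE.
  have : (0 <= I (x - 1)%R)%E by apply: integral_ge0 => t _; rewrite lee_fin.
  case: (I (x - 1)%R) => [r _|_|//]; first by rewrite -EFinM.
  by rewrite gt0_muley ?lte_fin//= mulr0.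
(* The boundary terms on the [n]-th interval. At the left end [1 <= x] gives [t ^ x <= t] for
   [t <= 1]; at the right end [powR_expRN_le] applies. *)
pose d n : R := f x n.+2%:R^-1 - f x n.+1%:R.
have d0 : d n @[n --> \oo] --> (0 : R).
  rewrite -[0 in X in _ --> X]subr0; apply: cvgB.
    apply: (@squeeze_cvgr _ _ _ _ (fun=> 0) (@harmonic R));
      [|exact: cvg_cst|exact: cvg_harmonic].
    near=> n; rewrite f0/=; have n0 : 0 < n.+2%:R^-1 :> R by [].
    have n1 : n.+2%:R^-1 <= 1 :> R by rewrite invf_le1// ler1n.
    apply: (@le_trans _ _ n.+2%:R^-1); last by rewrite lef_pV2 ?posrE// ler_nat.
    rewrite -[leRHS]mulr1 ler_pM ?powR_ge0 ?expR_ge0//.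
    by rewrite -[leRHS](powRr1 (ltW n0)) ger_powR// n0.
  pose N := (Num.truncn x).+1.
  apply: (@squeeze_cvgr _ _ _ _ (fun=> 0) (fun n => N.+1`!%:R * harmonic n)).
  - near=> n; rewrite f0/= powR_expRN_le// ?ler1n//.
    by rewrite ltW// /N truncnS_gt.
  - exact: cvg_cst.
  - rewrite -[0 in X in _ --> X](mulr0 N.+1`!%:R); apply: cvgM; first exact: cvg_cst.
    exact: cvg_harmonic.
have ltn n : n.+2%:R^-1 < n.+1%:R :> R.
  by rewrite (@lt_le_trans _ _ 1)// ?invf_lt1 ?ltr1n// ler1n.
have cI := cvg_integral0y (mf x) (f0 x).
have cJ := cvg_integral0y (mf (x - 1)) (f0 (x - 1)).
have cK : (\int[lebesgue_measure]_(t in `[(n.+2%:R^-1)%R, (n.+1%:R)%R]) (f x t)%:E)%E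
    @[n --> \oo] --> (0%:E + x%:E * I (x - 1)%R)%E.
  have -> : (fun n => \int[lebesgue_measure]_(t in `[(n.+2%:R^-1)%R, (n.+1%:R)%R])
      (f x t)%:E)%E = (fun n => (d n)%:E + x%:E *
      \int[lebesgue_measure]_(t in `[(n.+2%:R^-1)%R, (n.+1%:R)%R]) (f (x - 1)%R t)%:E)%E.
    apply/funext => n; rewrite integral_powR_expRN ?ltW// ?invr_gt0//.
    congr (_ + _)%E; rewrite -ge0_integralZl//= ?lee_fin ?ltW//.
      by apply/measurable_EFinP; exact: measurable_funS (mf _).
    by move=> t _; rewrite lee_fin.
  have cd : (d n)%:E @[n --> \oo] --> 0%:E by apply: cvg_EFin => //; near=> n.
  by apply: cvgeD cd _; [exact: fin_num_adde_defr|exact: cvgeZl].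
rewrite -[RHS]add0e; exact: (cvg_unique _ cI cK).
Unshelve. all: by end_near. Qed.

(** * Volumes of parallel sets *)

(* K x 0^q up to the equality m' = m + q: leaving m' free spares every cast
   between dimensions that are only propositionally equal. *)
Definition pad (R : realType) m m' (x : 'rV[R]_m) : 'rV[R]_m' :=
  \row_i (if insub (val i) is Some j then x ord0 j else 0).

Lemma cvg_rV (R : realType) (T : Type) (F : set_system T) {FF : Filter F} m
    (f : T -> 'rV[R]_m) (l : 'rV[R]_m) :
  (forall i, f x ord0 i @[x --> F] --> l ord0 i) -> f x @[x --> F] --> l.
Proof.
move=> fl; apply/cvg_ballP => e e0.
have : \forall x \near F, forall i, ball (l ord0 i) e (f x ord0 i).
  by apply: filter_forall => i; move/cvg_ballP : (fl i); exact.
by apply: filterS => x xl; split=> // i j; rewrite (ord1 i); exact: xl.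
Qed.

Lemma compact_pad (R : realType) m m' (K : set 'rV[R]_m) :
  compact K -> compact (@pad R m m' @` K).
Proof.
move=> cK; apply: continuous_compact => //; apply: continuous_subspaceT => x.
apply: (@cvg_rV _ _ _ (nbhs_filter x)) => i; rewrite /pad mxE.
under eq_fun do rewrite mxE.
by case: insub => [j|]; [exact: coord_continuous|exact: cvg_cst].
Qed.

Lemma unit_ball_coord (R : realType) m (x : 'rV[R]_m) i :
  unit_ball x -> `|x ord0 i| <= 1.
Proof.
rewrite /unit_ball/= (bigD1 i)//= => x1.
rewrite -(@expr_le1 _ 2)// real_normK ?num_real//.
by apply: le_trans x1; rewrite lerDl sumr_ge0// => j _; rewrite sqr_ge0.
Qed.

Lemma rV_norm_le (R : realType) m (x : 'rV[R]_m) (e : R) : 0 <= e ->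
  (forall i, `|x ord0 i| <= e) -> `|x| <= e.
Proof.
move=> e0 xe; rewrite [leLHS]/Num.Def.normr/= mx_normrE bigmax_le// => -[i j] _ /=.
by rewrite (ord1 i).
Qed.

Lemma rV_coord_le_norm (R : realType) m (x : 'rV[R]_m) i : `|x ord0 i| <= `|x|.
Proof.
rewrite [leRHS]/Num.Def.normr/= mx_normrE.
by apply/bigmax_geP; right => /=; exists (ord0, i).
Qed.

Lemma compact_unit_ball (R : realType) m : compact (@unit_ball R m).
Proof.
apply: bounded_closed_compact.
  exists 1; split; first exact: num_real.
  move=> M M1 x xB; apply: rV_norm_le; first by rewrite (le_trans _ (ltW M1)).
  by move=> i; rewrite (le_trans (unit_ball_coord i xB))// ltW.
rewrite (_ : @unit_ball R m = (fun x : 'rV[R]_m => \sum_i x ord0 i ^+ 2) @^-1`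
  [set y | y <= 1])//.
apply: preimage_closed; last exact: closed_le.
suff c : continuous (fun x : 'rV[R]_m => \sum_i x ord0 i ^+ 2).
  by move=> x _; exact: c.
apply: continuous_big => [|i _ x]; first exact: add_continuous.
apply: (@continuous_comp _ _ _ (fun x : 'rV[R]_m => x ord0 i)
  (fun y : R => y ^+ 2)).
  exact: coord_continuous.
exact: exprn_continuous.
Qed.

Lemma compact_parallel_set (R : realType) m (K : set 'rV[R]_m) (t : R) :
  compact K -> compact (parallel_set K t).
Proof.
move=> cK.
have -> : parallel_set K t = (fun z => z.1 + t *: z.2) @` (K `*` @unit_ball R m).
  apply/seteqP; split => [_ [x Kx] [b Bb] <-|_ [[x b] [/= Kx Bb]] <-].
    by exists (x, b).
  by exists x => //; exists b.
apply: continuous_compact; last first.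
  by apply: compact_setX => //; exact: compact_unit_ball.
apply: continuous_subspaceT => z; apply: cvgD; first exact: cvg_fst.
by apply: cvgZr; exact: cvg_snd.
Qed.

(** Squared distances are additive over coordinates, which suits slicing. The ball element is
    recovered as [t^-1 *: (x - k)], so [t = 0] is treated apart. *)
Lemma parallel_setE (R : realType) m (K : set 'rV[R]_m) (t : R) : 0 <= t ->
  parallel_set K t =
  [set x | exists2 k, K k & \sum_i (x ord0 i - k ord0 i) ^+ 2 <= t ^+ 2].
Proof.
rewrite le_eqVlt => /predU1P[<-|t0]; apply/seteqP; split.
- move=> _ [k Kk] [b Bb] <-; exists k => //.
  by rewrite expr0n/= big1// => i _; rewrite scale0r addr0 subrr expr0n.
- move=> x [k Kk]; rewrite expr0n/= => x0; suff <- : k = x.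
    exists k => //; exists 0; last by rewrite scaler0 addr0.
    by rewrite /unit_ball/= big1// => i _; rewrite mxE expr0n.
  have /eqP : \sum_i (x ord0 i - k ord0 i) ^+ 2 == 0.
    by rewrite eq_le x0 sumr_ge0// => i _; rewrite sqr_ge0.
  move/eqP; rewrite psumr_eq0 => [/allP xk|i _]; last by rewrite sqr_ge0.
  apply/rowP => i; apply/esym/eqP; rewrite -subr_eq0 -sqrf_eq0.
  by have /implyP := xk i (mem_index_enum _); exact.
- move=> _ [k Kk] [b Bb] <-; exists k => //.
  under eq_bigr do rewrite !mxE [X in X - _]addrC addrK exprMn.
  by rewrite -mulr_sumr ler_piMr// sqr_ge0.
- move=> x [k Kk xk]; exists k => //; exists (t^-1 *: (x - k)); last first.
    by rewrite scalerA divff ?gt_eqF// scale1r addrC subrK.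
  rewrite /unit_ball/=.
  under eq_bigr do rewrite !mxE exprMn.
  by rewrite -mulr_sumr exprVn mulrC ler_pdivrMr ?mul1r// exprn_gt0.
Qed.

Lemma parallel_set_le (R : realType) m (K : set 'rV[R]_m) (s t : R) :
  0 <= s -> s <= t -> parallel_set K s `<=` parallel_set K t.
Proof.
move=> s0 st; rewrite !parallel_setE ?(le_trans s0)// => x [k Kk xk].
by exists k => //; rewrite (le_trans xk)// lerXn2r// nnegrE (le_trans s0).
Qed.

Lemma parallel_set0 (R : realType) m (K : set 'rV[R]_m) : parallel_set K 0 = K.
Proof.
apply/seteqP; split=> [_ [x Kx] [b _] <-|x Kx].
  by rewrite scale0r addr0.
exists x => //; exists 0; last by rewrite scale0r addr0.
by rewrite /unit_ball/= big1// => i _; rewrite mxE expr0n.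
Qed.

(** * Measurability, finiteness and continuity of parallel volumes *)

Lemma measurable_open_tuple (R : realType) m (A : set 'rV[R]_m) : open A ->
  measurable [set u : m.-tuple (measurableTypeR R) | A (\row_i tnth u i)].
Proof.
move=> oA.
(* A is a countable union of cubes with rational centres *)
pose box (cn : m.-tuple rat * nat) := [set u : m.-tuple (measurableTypeR R) |
  forall i, ball (ratr (tnth cn.1 i) : R) (cn.2.+1%:R^-1) (tnth u i)].
pose D := [set cn : m.-tuple rat * nat |
  box cn `<=` [set u | A (\row_i tnth u i)]].
rewrite (_ : [set u | _] = \bigcup_(cn in D) box cn); last first.
  apply/seteqP; split => [u /= Au|u [cn Dcn] cnu]; last exact: Dcn.
  have [e /= e0 eA] := (nbhs_ballP _ _).1 (open_nbhs_nbhs (conj oA Au)).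
  (* Both the distance from [u] to the rational centre and the radius of the cube are at most
     [n.+1%:R^-1 < e / 2], so the cube stays in the [e]-ball around [u]. *)
  pose n := Num.truncn (2 / e).
  have ne : n.+1%:R^-1 < e / 2.
    rewrite -[ltRHS]invrK ltf_pV2 ?posrE ?invr_gt0 ?divr_gt0// invf_div.
    by rewrite truncnS_gt.
  have /choice[c cu] : forall i : 'I_m, exists q : rat,
      ball (tnth u i) n.+1%:R^-1 (ratr q : R).
    move=> i; have un : tnth u i < tnth u i + n.+1%:R^-1 by rewrite ltrDl.
    have [q] := rat_in_itvoo un.
    rewrite in_itv/= => /andP[uq qu]; exists q.
    by rewrite /ball/= distrC ger0_norm ?subr_ge0 1?ltW// ltrBlDl.
  exists ([tuple c i | i < m], n) => /=; last first.
    by move=> i /=; rewrite tnth_mktuple; exact: ball_sym.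
  move=> v /= vc; apply: eA; split => // i j; rewrite (ord1 i) !mxE.
  rewrite (splitr e); apply: (@ball_triangle _ _ (ratr (c j) : R)).
    exact: le_ball (ltW ne) _ (cu j).
  by apply: le_ball (ltW ne) _ _; have := vc j; rewrite tnth_mktuple.
(* The pairs of centre and radius are enumerated by [unpickle], which makes the union a countable
   one. *)
have -> : \bigcup_(cn in D) box cn = \bigcup_n
    (if unpickle n is Some cn then if `[< D cn >] then box cn else set0 else set0).
  apply/seteqP; split => [u [cn Dcn cnu]|u [n _]].
    by exists (pickle cn) => //; rewrite pickleK; case: asboolP.
  by case: unpickle => [cn|//]; case: asboolP => // Dcn cnu; exists cn.
apply: bigcupT_measurable => n; case: unpickle => [cn|//]; case: asboolP => // _.
rewrite (_ : box cn = \bigcap_(i in [set: 'I_m])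
  ((fun u : m.-tuple (measurableTypeR R) => tnth u i) @^-1`
    ball (ratr (tnth cn.1 i) : R) cn.2.+1%:R^-1)).
  apply: fin_bigcap_measurable => [|i _]; first exact: finite_finset.
  rewrite -[X in measurable X]setTI; apply: measurable_tnth => //.
  by rewrite ball_itv.
by apply/seteqP; split => u ucn i; [move=> _; exact: ucn|exact: (ucn i)].
Qed.

Lemma measurable_closed_tuple (R : realType) m (A : set 'rV[R]_m) : closed A ->
  measurable [set u : m.-tuple (measurableTypeR R) | A (\row_i tnth u i)].
Proof.
move=> cA; rewrite -[X in measurable X]setCK; apply: measurableC.
exact: measurable_open_tuple (closed_openC cA).
Qed.

Lemma measurable_compact_tuple (R : realType) m (A : set 'rV[R]_m) : compact A ->
  measurable [set u : m.-tuple (measurableTypeR R) | A (\row_i tnth u i)].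
Proof.
move=> cA; apply: measurable_closed_tuple.
by apply: compact_closed cA; exact: norm_hausdorff.
Qed.

Lemma measurable_parallel_set (R : realType) m (K : set 'rV[R]_m) (t : R) :
  compact K ->
  measurable [set u : m.-tuple (measurableTypeR R) |
    parallel_set K t (\row_i tnth u i)].
Proof.
by move=> cK; apply: measurable_compact_tuple; exact: compact_parallel_set.
Qed.

Lemma vol_compact_lty (R : realType) m (K : set 'rV[R]_m) : compact K ->
  (vol K < +oo)%E.
Proof.
move=> cK; have [M [_ KM]] := compact_bounded cK.
(* A bounding cube; [M + 1] because [KM] bounds the norm only by numbers strictly above [M]. *)
pose B := [set u : m.-tuple (measurableTypeR R) |
  forall i, `[- (M + 1), M + 1]%classic (tnth u i)].
have mB : measurable B.
  rewrite (_ : B = \bigcap_(i in [set: 'I_m])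
    ((fun u : m.-tuple (measurableTypeR R) => tnth u i) @^-1`
      `[- (M + 1), M + 1]%classic)).
    apply: fin_bigcap_measurable => [|i _]; first exact: finite_finset.
    by rewrite -[X in measurable X]setTI; apply: measurable_tnth.
  by apply/seteqP; split => u uB i; [move=> _; exact: uB|exact: (uB i)].
apply: (@le_lt_trans _ _ (lebesgue_tuple R m B)).
  apply: le_measure; rewrite ?inE//.
    exact: measurable_compact_tuple.
  move=> u /= Ku i; have /KM/(_ _ Ku) : M < M + 1 by rewrite ltrDl.
  rewrite /= in_itv/= -ler_norml; apply: le_trans.
  by have := rV_coord_le_norm (\row_i tnth u i) i; rewrite mxE.
rewrite (@lebesgue_tuple_box R m (fun=> `[- (M + 1), M + 1]%classic))//.
set x := (X in (X < _)%E); suff : x \is a fin_num by rewrite fin_numElt => /andP[].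
rewrite {}/x; elim/big_ind : _ => [//|x y|i _]; first exact: fin_numM.
by rewrite lebesgue_measure_itv; case: ifP.
Qed.

Lemma vol_parallel_fin_num (R : realType) m (K : set 'rV[R]_m) (t : R) :
  compact K -> vol (parallel_set K t) \is a fin_num.
Proof.
move=> cK; rewrite ge0_fin_numE ?measure_ge0//.
exact/vol_compact_lty/compact_parallel_set.
Qed.

Lemma vol_parallel_le (R : realType) m (K : set 'rV[R]_m) (s t : R) :
  compact K -> 0 <= s -> s <= t ->
  (vol (parallel_set K s) <= vol (parallel_set K t))%E.
Proof.
move=> cK s0 st; apply: le_measure; rewrite ?inE; try exact: measurable_parallel_set.
by move=> u /=; exact: parallel_set_le.
Qed.

(** A point of all these parallel sets is a limit of points of [K], which is closed. The sup norm of
    a ball element is at most 1, so Euclidean balls serve for the topology too. *)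
Lemma bigcap_parallel_set (R : realType) m (K : set 'rV[R]_m) : compact K ->
  \bigcap_n parallel_set K n.+1%:R^-1 = K.
Proof.
move=> cK; apply/seteqP; split=> [x Kx|x Kx n _]; last first.
  by apply: (@parallel_set_le _ _ _ 0) => //; rewrite parallel_set0.
have /closure_id -> : closed K by apply: compact_closed => //; exact: norm_hausdorff.
move=> B /nbhs_ballP[e /= e0 eB].
have [n ne] : exists n : nat, n.+1%:R^-1 < e.
  exists (Num.truncn e^-1); rewrite -[ltRHS]invrK ltf_pV2 ?posrE ?invr_gt0//.
  by rewrite truncnS_gt.
have [k Kk [b Bb kbx]] := Kx n I; exists k; split => //; apply: eB.
rewrite -ball_normE/= -kbx addrAC subrr add0r normrZ.
rewrite (le_lt_trans _ ne)// normfV normr_nat ler_piMr//.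
by apply: rV_norm_le => // i; exact: unit_ball_coord.
Qed.

(* Needed at t = 0 only, where the derivative of the lifted polynomial says
   nothing about vol K. *)
Lemma cvg_vol_parallel (R : realType) m (K : set 'rV[R]_m) : compact K ->
  vol (parallel_set K n.+1%:R^-1) @[n --> \oo] --> vol K.
Proof.
move=> cK; rewrite -[in X in _ --> X](bigcap_parallel_set cK).
pose F n := [set u : m.-tuple (measurableTypeR R) |
  parallel_set K n.+1%:R^-1 (\row_i tnth u i)].
have mF n : measurable (F n) by exact: measurable_parallel_set.
apply: (@nonincreasing_cvg_mu _ _ _ (lebesgue_tuple R m) F) => //.
- rewrite -ge0_fin_numE ?measure_ge0//; exact: vol_parallel_fin_num.
- exact: bigcapT_measurable.
- move=> i j ij; apply/subsetPset => u; apply: parallel_set_le => //.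
  by rewrite lef_pV2 ?posrE// ler_nat.
Qed.

(** * Slicing by the last two coordinates *)

Lemma lebesgue_tuple_cons (R : realType) m (A : set (m.+1.-tuple (measurableTypeR R))) :
  (lebesgue_tuple R m.+1 A =
   \int[@lebesgue_measure R]_x
     lebesgue_tuple R m [set u : m.-tuple (measurableTypeR R) | A (cons_tuple x u)])%E.
Proof.
rewrite /= /lebesgue_step /pushforward /product_measure1; apply: eq_integral => x _ /=.
congr (lebesgue_tuple R m _); apply/seteqP; split => u; rewrite /xsection/= inE/=.
  by congr A; exact: val_inj.
by congr A; exact: val_inj.
Qed.

Lemma measurable_rcons (R : realType) d (U : measurableType d) m
    (f : U -> m.-tuple (measurableTypeR R)) (g : U -> measurableTypeR R) :
  measurable_fun setT f -> measurable_fun setT g ->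
  measurable_fun setT (fun z => rcons_tuple (f z) (g z)).
Proof.
move=> mf mg; apply/measurable_fun_tnthP => i.
have [im|mi] := ltnP i m.
  rewrite (_ : _ \o _ = fun z => tnth (f z) (Ordinal im)); last first.
    apply/funext => z /=; rewrite !(tnth_nth (g z))/=.
    by rewrite nth_rcons size_tuple im.
  apply: (@measurableT_comp _ _ _ _ _ _ (fun u => tnth u (Ordinal im))) => //.
  exact: measurable_tnth.
rewrite (_ : _ \o _ = g)//; apply/funext => z /=.
rewrite (tnth_nth (g z))/= nth_rcons size_tuple ltnNge mi/=.
by case: ifP.
Qed.

(** The measure is built by adding coordinates in front, whereas [pad] appends them at the end. By
    induction, Tonelli exchanges the integrals over the first and the last coordinate. *)
Lemma lebesgue_tuple_rcons (R : realType) m (A : set (m.+1.-tuple (measurableTypeR R))) :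
  measurable A ->
  (lebesgue_tuple R m.+1 A =
   \int[@lebesgue_measure R]_x
     lebesgue_tuple R m [set u : m.-tuple (measurableTypeR R) | A (rcons_tuple u x)])%E.
Proof.
elim: m A => [|m IH] A mA; rewrite lebesgue_tuple_cons.
  apply: eq_integral => x _; congr (lebesgue_tuple R 0 _).
  by apply/seteqP; split => u /=; rewrite (tuple0 u)/=; congr A; exact: val_inj.
pose T := measurableTypeR R.
(* Grouping the first and last coordinates makes the inner measure a section measure over their
   plane, hence jointly measurable. *)
pose B := [set z : (T * T) * m.-tuple T | A (cons_tuple z.1.1 (rcons_tuple z.2 z.1.2))].
have mB : measurable B.
  rewrite -[X in measurable X]setTI.
  suff mf : measurable_fun setT (fun z : (T * T) * m.-tuple T =>
    cons_tuple z.1.1 (rcons_tuple z.2 z.1.2)) by exact: mf.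
  apply: measurable_cons; first exact: measurableT_comp.
  by apply: measurable_rcons => //; exact: measurableT_comp.
transitivity (\int[@lebesgue_measure R]_x \int[@lebesgue_measure R]_y
    lebesgue_tuple R m (xsection B (x, y)))%E.
  apply: eq_integral => x _; rewrite IH; last first.
    rewrite -[X in measurable X]setTI.
    suff mf : measurable_fun setT (fun u : m.+1.-tuple T => cons_tuple x u) by exact: mf.
    by apply: measurable_cons => //; exact: measurable_cst.
  apply: eq_integral => y _; congr (lebesgue_tuple R m _).
  by apply/seteqP; split => u; rewrite /xsection/= inE.
have mBx := measurable_fun_xsection (lebesgue_tuple R m) mB.
etransitivity; first by apply: (fubini_tonelli _ mBx) => z; exact: measure_ge0.
apply: eq_integral => y _; rewrite lebesgue_tuple_cons.
apply: eq_integral => x _; congr (lebesgue_tuple R m _).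
apply/seteqP; split => u; rewrite /xsection/= inE/=.
  by congr A; exact: val_inj.
by congr A; exact: val_inj.
Qed.

(** The parallel volume as a function of the squared radius. Extended by 0 to negative [w] it is
    monotone on the whole line, hence measurable, and fits [integral_sqnorm2]. *)
Definition vol_parallel_sqrt (R : realType) m (K : set 'rV[R]_m) (w : R) : \bar R :=
  if 0 <= w then vol (parallel_set K (Num.sqrt w)) else 0%E.

Lemma vol_parallel_sqrt_ge0 (R : realType) m (K : set 'rV[R]_m) (w : R) :
  (0 <= vol_parallel_sqrt K w)%E.
Proof. by rewrite /vol_parallel_sqrt; case: ifP => // _; exact: measure_ge0. Qed.

Lemma vol_parallel_sqrt_fin_num (R : realType) m (K : set 'rV[R]_m) (w : R) :
  compact K -> vol_parallel_sqrt K w \is a fin_num.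
Proof.
by move=> cK; rewrite /vol_parallel_sqrt; case: ifP => // _; exact: vol_parallel_fin_num.
Qed.

Lemma vol_parallel_sqrt_le (R : realType) m (K : set 'rV[R]_m) :
  compact K -> {homo (vol_parallel_sqrt K) : v w / v <= w >-> (v <= w)%E}.
Proof.
move=> cK v w vw; rewrite {1}/vol_parallel_sqrt; case: ifPn => [v0|_]; last first.
  exact: vol_parallel_sqrt_ge0.
rewrite /vol_parallel_sqrt (le_trans v0 vw).
by apply: vol_parallel_le; rewrite ?sqrtr_ge0// ler_wsqrtr.
Qed.

Lemma measurable_vol_parallel_sqrt (R : realType) m (K : set 'rV[R]_m) :
  compact K -> measurable_fun [set: measurableTypeR R] (vol_parallel_sqrt K).
Proof.
move=> cK.
rewrite (_ : vol_parallel_sqrt K = EFin \o (fine \o vol_parallel_sqrt K)); last first.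
  by apply/funext => w /=; rewrite fineK// vol_parallel_sqrt_fin_num.
apply/measurable_EFinP; apply: nondecreasing_measurable => // v w vw /=.
by rewrite fine_le ?vol_parallel_sqrt_fin_num// vol_parallel_sqrt_le.
Qed.

(** Pythagoras: the flat coordinates of every point of the padded body are 0, so [y] and [z] use up
    [z^2 + y^2] of the squared distance allowed. *)
Lemma pad_rcons2 (R : realType) m (K : set 'rV[R]_m) (t y z : R)
    (u : m.-tuple (measurableTypeR R)) : 0 <= t ->
  parallel_set (@pad R m m.+2 @` K) t
    (\row_i tnth (rcons_tuple (rcons_tuple u y) z) i) <->
  0 <= t ^+ 2 - (z ^+ 2 + y ^+ 2) /\
  parallel_set K (Num.sqrt (t ^+ 2 - (z ^+ 2 + y ^+ 2))) (\row_i tnth u i).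
Proof.
move=> t0.
have padE (k : 'rV[R]_m) :
    \sum_i ((\row_i tnth (rcons_tuple (rcons_tuple u y) z) i) ord0 i -
      pad m.+2 k ord0 i) ^+ 2 =
    \sum_i ((\row_i tnth u i) ord0 i - k ord0 i) ^+ 2 + (z ^+ 2 + y ^+ 2).
  rewrite 2!big_ord_recr/= -addrA; congr (_ + _).
    apply: eq_bigr => i _; rewrite !mxE/= insubT//= => im.
    rewrite !(tnth_nth 0)/= !nth_rcons !size_rcons !size_tuple ltnW// im.
    congr ((_ - k _ _) ^+ 2); exact: val_inj.
  rewrite !mxE/= !insubF ?ltnn ?ltnNge ?leqnSn//= !subr0.
  rewrite !(tnth_nth 0)/= !nth_rcons !size_rcons !size_tuple !ltnn !eqxx ltnSn.
  by rewrite addrC.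
rewrite !parallel_setE ?sqrtr_ge0//; split.
  move=> [_ [k Kk <-]]; rewrite padE => kt.
  have s0 : 0 <= \sum_i ((\row_i tnth u i) ord0 i - k ord0 i) ^+ 2.
    by apply: sumr_ge0 => i _; rewrite sqr_ge0.
  have w0 : 0 <= t ^+ 2 - (z ^+ 2 + y ^+ 2) by lra.
  by split => //; exists k => //; rewrite sqr_sqrtr//; lra.
move=> [w0 [k Kk]]; rewrite sqr_sqrtr// => kt.
by exists (pad m.+2 k); [exists k|rewrite padE; lra].
Qed.

Lemma vol_pad2 (R : realType) m (K : set 'rV[R]_m) (t : R) : compact K -> 0 <= t ->
  (vol (parallel_set (@pad R m m.+2 @` K) t) =
   pi%:E * \int[lebesgue_measure]_(w in `[0%R, (t ^+ 2)%R])
     vol (parallel_set K (Num.sqrt w)))%E.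
Proof.
move=> cK t0.
pose T := measurableTypeR R; pose mu := @lebesgue_measure R.
pose A := [set u : m.+2.-tuple T | parallel_set (@pad R m m.+2 @` K) t (\row_i tnth u i)].
have mA : measurable A by apply: measurable_parallel_set; exact: compact_pad.
have mh : measurable_fun setT (fun z : T * T => vol_parallel_sqrt K (t ^+ 2 - sqnorm2 z)).
  apply: (measurableT_comp (measurable_vol_parallel_sqrt cK)).
  by apply: measurable_funB => //; exact: measurable_sqnorm2.
transitivity (\int[mu \x mu]_z vol_parallel_sqrt K (t ^+ 2 - sqnorm2 z)%R)%E.
  rewrite (fubini_tonelli1 _ mh); last by move=> z; exact: vol_parallel_sqrt_ge0.
  rewrite [LHS](lebesgue_tuple_rcons mA); apply: eq_integral => z _.
  rewrite lebesgue_tuple_rcons; last first.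
    rewrite -[X in measurable X]setTI.
    suff mf : measurable_fun setT (fun u : m.+1.-tuple T => rcons_tuple u z) by exact: mf.
    by apply: measurable_rcons.
  apply: eq_integral => y _; rewrite /vol_parallel_sqrt/=; case: ifPn => [w0|w0].
    congr (lebesgue_tuple R m _); apply/seteqP; split=> u /=.
      by move=> /pad_rcons2 => /(_ t0)[].
    by move=> uw; apply/pad_rcons2.
  rewrite -(measure0 (lebesgue_tuple R m)); congr (lebesgue_tuple R m _).
  apply/seteqP; split=> u //= /pad_rcons2 => /(_ t0)[w0' _].
  by move: w0; rewrite /sqnorm2/= w0'.
rewrite integral_sqnorm2//.
- congr (_ * _)%E; apply: eq_integral => w; rewrite inE/= in_itv/= => /andP[w0 _].
  by rewrite /vol_parallel_sqrt w0.
- exact: measurable_vol_parallel_sqrt.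
- by move=> w; exact: vol_parallel_sqrt_ge0.
- by move=> w w0; rewrite /vol_parallel_sqrt leNgt w0.
Qed.

(** * Steiner polynomials of flat bodies *)

(** Otherwise the nonzero [P - Q] would have as roots the first [size (P - Q)] natural numbers, one
    more than its degree. *)
Lemma poly_eq_nneg (R : realType) (P Q : {poly R}) :
  (forall t, 0 <= t -> P.[t] = Q.[t]) -> P = Q.
Proof.
move=> PQ; apply/eqP; rewrite -subr_eq0; apply/negPn/negP => PQ0.
pose rs : seq R := [seq i%:R | i <- iota 0 (size (P - Q))].
have := @max_poly_roots R (P - Q) rs PQ0; rewrite size_map size_iota ltnn => H.
suff : false by []; apply: H.
  apply/allP => _ /mapP[i _ ->].
  by rewrite /root hornerD hornerN PQ ?ler0n// subrr.
by rewrite map_inj_uniq ?iota_uniq// => i j /eqP; rewrite eqr_nat => /eqP.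
Qed.

Lemma steiner_polyE (R : realType) m (K : set 'rV[R]_m) (P : {poly R}) :
  is_steiner_poly K P -> steiner_poly K = P.
Proof.
move=> KP; apply: xget_unique => // Q [_ KQ]; apply: poly_eq_nneg => t t0.
by apply: EFin_inj; rewrite -KQ// -KP.2.
Qed.

(* 2 pi \int_0^t s P(s) ds, as a polynomial in t *)
Definition steiner_lift (R : realType) (P : {poly R}) : {poly R} :=
  \poly_(i < (size P).+2) (if i is j.+2 then 2 * pi / i%:R * P`_j else 0).

Lemma coef_steiner_lift (R : realType) (P : {poly R}) i :
  (steiner_lift P)`_i = (if i is j.+2 then 2 * pi / i%:R * P`_j else 0).
Proof.
rewrite coef_poly; case: ltnP => //; case: i => [|[|i]]//.
by rewrite !ltnS => Pi; rewrite nth_default// mulr0.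
Qed.

Lemma deriv_steiner_lift (R : realType) (P : {poly R}) :
  (steiner_lift P)^`() = (2 * pi) *: ('X * P).
Proof.
apply/polyP => i; rewrite coef_deriv coef_steiner_lift coefZ coefXM.
case: i => [|i] /=; first by rewrite mulr0 mul0rn.
by rewrite -[_ *+ i.+2]mulr_natr mulrAC divfK// pnatr_eq0.
Qed.

Lemma horner_steiner_lift0 (R : realType) (P : {poly R}) : (steiner_lift P).[0] = 0.
Proof. by rewrite horner_coef0 coef_steiner_lift. Qed.

Lemma is_steiner_poly_lift (R : realType) m (K : set 'rV[R]_m) (P : {poly R}) :
  compact K -> is_steiner_poly K P ->
  is_steiner_poly (@pad R m m.+2 @` K) (steiner_lift P).
Proof.
move=> cK [szP KP]; split; first by rewrite (leq_trans (size_poly _ _))// !ltnS.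
move=> t t0; rewrite vol_pad2//.
have cs : continuous (@Num.sqrt R) by exact: sqrt_continuous.
under eq_integral => w; first rewrite inE/= in_itv/= => /andP[w0 _].
  rewrite KP ?sqrtr_ge0//; over.
(* By [deriv_steiner_lift], the factor [2 * pi * Num.sqrt w] of the derivative cancels [pi^-1] and
   the derivative of the square root. *)
rewrite (@integral_is_derive _ _ (fun w => pi^-1 * (steiner_lift P).[Num.sqrt w])).
- rewrite sqrtr0 horner_steiner_lift0 mulr0 subr0 sqrtr_sqr ger0_norm//.
  by rewrite -EFinM mulrA divff ?mul1r// gt_eqF ?pi_gt0.
- by rewrite sqr_ge0.
- by move=> w; apply: (continuous_comp (cs w)); exact: continuous_horner.
- move=> w; apply: cvgM; first exact: cvg_cst.
  by apply: (continuous_comp (cs w)); exact: continuous_horner.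
- move=> w; rewrite in_itv/= => /andP[w0 _].
  have s0 : 0 < Num.sqrt w by rewrite sqrtr_gt0.
  have -> : P.[Num.sqrt w] =
      pi^-1 * ((steiner_lift P)^`().[Num.sqrt w] * (2 * Num.sqrt w)^-1).
    move: (Num.sqrt w) s0 => x x0; rewrite deriv_steiner_lift hornerZ hornerM hornerX.
    by move: pi (pi_gt0 R) => c c0; field; rewrite !gt_eqF.
  apply: is_deriveZ; apply: (@is_derive1_comp _ (horner (steiner_lift P)) Num.sqrt).
  exact: is_derive1_sqrt.
Qed.

(** * Recovering the Steiner polynomial of a body from that of its flat lift *)

(* Monotonicity of the parallel volume under the integral; letting t - s -> 0
   recovers vol (parallel_set K) from Q^`() without knowing its continuity. *)
Lemma vol_pad2_bounds (R : realType) m (K : set 'rV[R]_m) (Q : {poly R}) (s t : R) :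
  compact K ->
  (forall r, 0 <= r -> vol (parallel_set (@pad R m m.+2 @` K) r) = Q.[r]%:E) ->
  0 <= s -> s < t ->
  pi * (t + s) * fine (vol (parallel_set K s)) * (t - s) <= Q.[t] - Q.[s] <=
  pi * (t + s) * fine (vol (parallel_set K t)) * (t - s).
Proof.
move=> cK KQ s0 st; have t0 : 0 <= t by rewrite (le_trans s0)// ltW.
pose G w := vol (parallel_set K (Num.sqrt w)).
have st2 : s ^+ 2 < t ^+ 2 by rewrite ltrXn2r.
have mG (D : set (measurableTypeR R)) :
    measurable D -> D `<=` `[0, +oo[ -> measurable_fun D G.
  move=> mD D0; apply: (eq_measurable_fun (vol_parallel_sqrt K)).
    move=> w; rewrite inE => /D0/=; rewrite in_itv/= andbT => w0.
    by rewrite /vol_parallel_sqrt w0.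
  apply: measurable_funS (measurable_vol_parallel_sqrt cK) => //.
(* The formula [vol_pad2] at [t] minus the same at [s], written as a sum to avoid subtracting
   extended reals. *)
have QE : (Q.[t]%:E = Q.[s]%:E + pi%:E *
    \int[lebesgue_measure]_(w in `](s ^+ 2)%R, (t ^+ 2)%R]) G w)%E.
  rewrite -!KQ// !vol_pad2// -ge0_muleDr; last 2 first.
  - by apply: integral_ge0 => w _; exact: measure_ge0.
  - by apply: integral_ge0 => w _; exact: measure_ge0.
  congr (_ * _)%E; rewrite -ge0_integral_setU//=.
  - by rewrite -itv_bndbnd_setU// bnd_simp ?sqr_ge0// ltW.
  - apply: mG; first exact: measurableU.
    move=> w /=; rewrite !in_itv/= andbT => -[/andP[]//|/andP[+ _]].
    by move=> /ltW; apply: le_trans; rewrite sqr_ge0.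
  - rewrite disj_set2E; apply/eqP/seteqP; split => // w [] /=.
    rewrite !in_itv/= => /andP[_ ws] /andP[sw _].
    by move: sw; rewrite ltNge ws.
pose I := (\int[lebesgue_measure]_(w in `](s ^+ 2)%R, (t ^+ 2)%R]) G w)%E.
have cstE (k : R) :
    (\int[lebesgue_measure]_(w in `](s ^+ 2)%R, (t ^+ 2)%R]) (cst k%:E) w =
    (k * (t ^+ 2 - s ^+ 2))%R%:E)%E.
  by rewrite integral_cst//= lebesgue_measure_itv/= lte_fin st2 -EFinB -EFinM.
have mGst : measurable_fun `](s ^+ 2)%R, (t ^+ 2)%R] G.
  apply: mG => // w /=; rewrite !in_itv/= andbT => /andP[sw _].
  by apply: le_trans (ltW sw); rewrite sqr_ge0.
have lo : ((fine (vol (parallel_set K s)) * (t ^+ 2 - s ^+ 2))%R%:E <= I)%E.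
  rewrite -cstE; apply: ge0_le_integral => //.
  - by move=> w _; rewrite lee_fin fine_ge0// measure_ge0.
  - move=> w; rewrite /= in_itv/= => /andP[sw _].
    rewrite fineK ?vol_parallel_fin_num// vol_parallel_le//.
    by rewrite -(ger0_norm s0) -sqrtr_sqr ler_wsqrtr// ltW.
have hi : (I <= (fine (vol (parallel_set K t)) * (t ^+ 2 - s ^+ 2))%R%:E)%E.
  rewrite -cstE; apply: ge0_le_integral => //.
  move=> w; rewrite /= in_itv/= => /andP[sw wt].
  rewrite fineK ?vol_parallel_fin_num// vol_parallel_le// ?sqrtr_ge0//.
  by rewrite -(ger0_norm t0) -sqrtr_sqr ler_wsqrtr.
have Ifin : I \is a fin_num.
  by rewrite fin_numElt (lt_le_trans _ lo) ?ltNyr//= (le_lt_trans hi)// ltry.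
move: QE lo hi; rewrite -/I -(fineK Ifin) -EFinM -EFinD !lee_fin => -[->].
rewrite addrAC subrr add0r subr_sqr => lo hi; have pi0 := pi_gt0 R.
have piE (x : R) : pi * (t + s) * x * (t - s) = pi * (x * ((t - s) * (t + s))).
  by ring.
by rewrite !piE !ler_pM2l// lo hi.
Qed.

Lemma poly_ge0_right (R : realType) (p : {poly R}) (a b : R) : a < b ->
  (forall x, a < x -> x < b -> 0 <= p.[x]) -> 0 <= p.[a].
Proof.
move=> ab p0; apply: (@cvgr_to_ge _ a^'+ _ _ (horner p)).
  exact: (cvg_at_right_filter (@continuous_horner _ p a)).
by near=> x; apply: p0; near: x; [exact: nbhs_right_gt|exact: nbhs_right_lt].
Unshelve. all: by end_near. Qed.

Lemma poly_ge0_left (R : realType) (p : {poly R}) (a b : R) : a < b ->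
  (forall x, a < x -> x < b -> 0 <= p.[x]) -> 0 <= p.[b].
Proof.
move=> ab p0; apply: (@cvgr_to_ge _ b^'- _ _ (horner p)).
  exact: (cvg_at_left_filter (@continuous_horner _ p b)).
by near=> x; apply: p0; near: x; [exact: nbhs_left_gt|exact: nbhs_left_lt].
Unshelve. all: by end_near. Qed.

(** The difference quotient of a polynomial is again a polynomial, so bounds on it pass to the
    derivative by mere continuity. *)
Lemma poly_slope (R : idomainType) (Q : {poly R}) (s : R) :
  exists2 D : {poly R}, D.[s] = Q^`().[s] & forall t, Q.[t] - Q.[s] = D.[t] * (t - s).
Proof.
have /factor_theorem[D QD] : root (Q - Q.[s]%:P) s by rewrite /root !hornerE subrr.
exists D => [|t]; last first.
  by have := congr1 (horner^~ t) QD; rewrite !hornerE.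
have := congr1 (fun p => p^`().[s]) QD.
by rewrite derivB derivC subr0 derivM derivXsubC !hornerE subrr mulr0 add0r => ->.
Qed.

Section inverse_lift.
Variables (R : realType) (m : nat) (K : set 'rV[R]_m) (Q : {poly R}).
Hypothesis cK : compact K.
Hypothesis KQ : forall r, 0 <= r ->
  vol (parallel_set (@pad R m m.+2 @` K) r) = Q.[r]%:E.
Let g s := fine (vol (parallel_set K s)).

(** The lower bound of [vol_pad2_bounds], divided by [t - s], as [t] decreases to [s]. *)
Let dQ_ge s : 0 <= s -> pi * (s + s) * g s <= Q^`().[s].
Proof.
move=> s0; have [D <- QD] := poly_slope Q s.
pose p := D - (pi * g s) *: ('X + s%:P).
have pE x : p.[x] = D.[x] - pi * (x + s) * g s by rewrite !hornerE; ring.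
rewrite -subr_ge0 -pE; apply: (@poly_ge0_right _ _ _ (s + 1)); first by rewrite ltrDl.
move=> t st _; rewrite pE subr_ge0.
have /andP[+ _] := vol_pad2_bounds cK KQ s0 st.
by rewrite QD ler_pM2r// subr_gt0.
Qed.

(** The upper bound, as [s] increases to [t]; this needs room to the left of [t], hence [0 < t]. *)
Let dQ_le t : 0 < t -> Q^`().[t] <= pi * (t + t) * g t.
Proof.
move=> t0; have [D <- QD] := poly_slope Q t.
pose p := (pi * g t) *: ('X + t%:P) - D.
have pE x : p.[x] = pi * (x + t) * g t - D.[x] by rewrite !hornerE; ring.
rewrite -subr_ge0 -pE; apply: (@poly_ge0_left _ _ 0) => // s s0 st.
rewrite pE subr_ge0.
have /andP[_] := vol_pad2_bounds cK KQ (ltW s0) st.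
have -> : Q.[t] - Q.[s] = D.[s] * (t - s) by rewrite -opprB QD -mulrN opprB.
by rewrite ler_pM2r ?subr_gt0// [t + s]addrC.
Qed.

(** The derivative of [Q] equals [2 * pi * t * g t] for [t > 0] and vanishes at 0, so dividing it by
    [2 * pi * 'X] gives a polynomial equal to [g] for [t > 0]; the value at 0 follows by continuity
    of both sides. *)
Lemma is_steiner_poly_unlift : (size Q <= m.+3)%N -> exists P, is_steiner_poly K P.
Proof.
move=> szQ; have dQE t : 0 < t -> Q^`().[t] = pi * (t + t) * g t.
  by move=> t0; apply/eqP; rewrite eq_le dQ_le// dQ_ge// ltW.
have dQ0 : root Q^`() 0.
  rewrite /root eq_le; apply/andP; split; last first.
    by have := dQ_ge (lexx 0); rewrite addr0 mulr0 mul0r.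
  (* Since [g t <= g 1] on []0, 1[], the derivative is at most [2 * pi * g 1 * t] there, which
     forces its value at 0 to be at most 0. *)
  pose p := (2 * pi * g 1) *: 'X - Q^`().
  have pE x : p.[x] = 2 * pi * g 1 * x - Q^`().[x] by rewrite !hornerE.
  rewrite -oppr_ge0 -[leRHS]add0r -[X in X - _](mulr0 (2 * pi * g 1)) -pE.
  apply: (@poly_ge0_right _ _ _ 1) => // t t0 t1; rewrite pE dQE//.
  have -> : 2 * pi * g 1 * t - pi * (t + t) * g t = 2 * pi * t * (g 1 - g t) by ring.
  rewrite !mulr_ge0 ?pi_ge0// ?(ltW t0)// subr_ge0 /g fine_le ?vol_parallel_fin_num//.
  by apply: vol_parallel_le => //; exact: ltW.
have [P0] := factor_theorem _ _ dQ0; rewrite subr0 => dQP.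
pose P := (2 * pi)^-1 *: P0.
have Pg t : 0 < t -> P.[t] = g t.
  move=> t0; have := dQE _ t0; rewrite dQP hornerM hornerX /P hornerZ => P0t.
  have -> : P0.[t] = 2 * pi * g t.
    by apply: (mulIf (lt0r_neq0 t0)); rewrite P0t; ring.
  by rewrite mulKf// mulf_neq0// gt_eqF// pi_gt0.
exists P; split.
  rewrite (leq_trans (size_scale_leq _ _))//.
  have [->|P00] := eqVneq P0 0; first by rewrite size_poly0.
  have Q0 : Q != 0.
    apply: contra_neq P00 => Q0; apply: (mulIf (negbT (polyX_eq0 R))).
    by rewrite -dQP Q0 deriv0 mul0r.
  by have := leq_trans (lt_size_deriv Q0) szQ; rewrite dQP size_mulX.
have PK : EFin \o (fun n : nat => P.[n.+1%:R^-1]) @ \oo --> vol K.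
  rewrite (_ : _ \o _ = fun n => vol (parallel_set K n.+1%:R^-1)).
    exact: cvg_vol_parallel.
  by apply/funext => n /=; rewrite Pg// /g fineK// vol_parallel_fin_num.
have PH : P.[n.+1%:R^-1] @[n --> \oo] --> P.[0].
  apply: (@cvg_comp _ _ _ _ (horner P) _ (nbhs (0 : R))); first exact: cvg_harmonic.
  exact: continuous_horner.
have P0K : EFin \o (fun n : nat => P.[n.+1%:R^-1]) @ \oo --> P.[0]%:E.
  by apply: cvg_EFin; [near=> n|exact: PH].
move=> t; rewrite le_eqVlt => /predU1P[<-|t0].
  by rewrite parallel_set0; apply: (cvg_unique _ PK P0K).
by rewrite Pg// /g fineK// vol_parallel_fin_num.
Unshelve. all: by end_near. Qed.

End inverse_lift.

Lemma steiner_poly_pad (R : realType) m (K : set 'rV[R]_m) : compact K ->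
  steiner_poly (@pad R m m.+2 @` K) = steiner_lift (steiner_poly K).
Proof.
move=> cK; have [[P KP]|nP] := pselect (exists P, is_steiner_poly K P).
  by rewrite (steiner_polyE KP) (steiner_polyE (is_steiner_poly_lift cK KP)).
(* No Steiner polynomial exists on either side: both default to 0, and the lift of 0 is 0. *)
rewrite /steiner_poly !xgetPN.
- by apply/polyP => -[|[|i]]; rewrite coef_steiner_lift !coef0// mulr0.
- by move=> P KP; apply: nP; exists P.
- move=> Q [szQ KQ]; apply: nP; exact: is_steiner_poly_unlift cK KQ szQ.
Qed.

Lemma steiner_coef_pad (R : realType) m m' (K : set 'rV[R]_m) (k : nat) :
  compact K -> m' = m.+2 ->
  steiner_coef (@pad R m m' @` K) k =
    (if k is j.+2 then 2 * pi / k%:R * steiner_coef K j else 0).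
Proof.
by move=> cK ->; rewrite /steiner_coef steiner_poly_pad// coef_steiner_lift.
Qed.

(** * Weyl polynomials of flat bodies *)

Lemma pad_id (R : realType) m (x : 'rV[R]_m) : pad m x = x.
Proof. by apply/rowP => i; rewrite mxE valK. Qed.

(** [pad] truncates when the target dimension is smaller, so the intermediate dimension must keep
    all coordinates of [x]. *)
Lemma pad_pad (R : realType) m m' m'' (x : 'rV[R]_m) : (m <= m')%N ->
  pad m'' (pad m' x) = pad m'' x.
Proof.
move=> mm'; apply/rowP => i; rewrite !mxE.
case: insubP => [j _ ji|]; first by rewrite mxE ji.
rewrite -leqNgt => m'i; case: insubP => // k; lia.
Qed.

Lemma prod0_pad (R : realType) n q (V : set 'rV[R]_n) :
  prod0 q V = @pad R n (n + q) @` V.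
Proof.
apply: eq_imagel => x _; apply/rowP => i; rewrite [LHS]mxE [RHS]mxE.
case: splitP => j ij; first by rewrite [val i]ij valK.
by case: insubP => [k|]; rewrite ?mxE// [val i]ij ltnNge leq_addr.
Qed.

(** The term [l.+1] on the left equals the term [l] on the right: the factor [p / 2 + 1] links the
    omegas and the Gamma numerators, and [l + 3 / 2] from Gamma cancels the [2 * l + 3] of the
    lifted Steiner coefficient. *)
Lemma weyl_pad2 (R : realType) m m' p (K : set 'rV[R]_m) (t : R) :
  compact K -> m' = m.+2 ->
  omega R p * t ^+ p * (weyl_poly (@pad R m m' @` K) p).[t] =
  omega R p.+2 * t ^+ p.+2 * (weyl_poly K p.+2).[t].
Proof.
move=> cK m'E; subst m'; rewrite /weyl_poly !horner_sum.
have G2 : Gamma ((p.+2)%:R / 2 + 1 : R) = (p%:R / 2 + 1) * Gamma (p%:R / 2 + 1).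
  rewrite -GammaD1; first by congr Gamma; rewrite -addn2 natrD; field.
  by rewrite lerDr divr_ge0.
have pS : (p.+2)%:R / 2 = p%:R / 2 + 1 :> R by rewrite -addn2 natrD; field.
have oS : omega R p.+2 = pi * pi `^ (p%:R / 2) / Gamma ((p.+2)%:R / 2 + 1).
  rewrite /omega pS powRD; last by rewrite (gt_eqF (pi_gt0 R)) implybT.
  by rewrite powRr1 ?pi_ge0// [_ * pi]mulrC.
(* if Gamma(p/2 + 1) were 0, then so would be Gamma(p/2 + 2), and both omegas
   would be 0 by the convention x / 0 = 0 *)
have [G0|G0] := eqVneq (Gamma (p%:R / 2 + 1 : R)) 0.
  by rewrite oS G2 /omega G0 mulr0 !invr0 !mulr0 !mul0r.
(* The left sum has two more indices: the term 0 vanishes because the flat body has [s_1 = 0], and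
   the index [m.+1] violates the range condition. *)
rewrite big_mkcond big_ord_recl/= muln0 /weyl_coef muln0 steiner_coef_pad//=.
rewrite !mulr0 scale0r horner0 add0r big_ord_recr/= /bump/=.
rewrite [X in _ + X]ifF ?addr0; last by lia.
rewrite !mulr_sumr [RHS]big_mkcond/=.
apply: eq_bigr => l _; rewrite add1n.
rewrite (_ : ((2 * l.+1).+1 <= m.+2)%N = ((2 * l).+1 <= m)%N); last by lia.
case: ifPn => lm; last by rewrite mulr0.
rewrite (_ : (2 * l.+1)%N = (2 * l).+2); last by lia.
rewrite steiner_coef_pad// !hornerZ !hornerXn oS.
rewrite (_ : p%:R / 2 + l.+1%:R = p.+2%:R / 2 + l%:R); last first.
  by rewrite pS -(addn1 l) natrD; ring.
rewrite (_ : l.+1%:R + 2^-1 + 1 = (l%:R + 2^-1 + 1) + 1); last first.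
  by rewrite -(addn1 l) natrD; ring.
rewrite [Gamma (_ + 1 + 1)]GammaD1; last by rewrite lerDr addr_ge0.
have l0 : (2 * l).+3%:R = 2 * (l%:R + 2^-1 + 1) :> R.
  by rewrite -addn3 natrD natrM; field.
rewrite l0 G2 /omega.
set a := l%:R + 2^-1 + 1.
have a0 : a != 0 by rewrite gt_eqF// ltr_wpDl// addr_ge0.
have p0 : p%:R / 2 + 1 != 0 :> R by rewrite gt_eqF// ltr_wpDl// divr_ge0.
have e0 : 2 ^+ l != 0 :> R by rewrite expf_neq0.
rewrite !exprS; set c := Gamma (p%:R / 2 + 1) in G0 *.
(* The inverses [u] and [v] occur alike on both sides and are kept opaque, so [c] is the only Gamma
   value that has to be nonzero. *)
set b := p%:R / 2 + 1 in p0 *; set u := (Gamma (p.+2%:R / 2 + l%:R + 1))^-1.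
set v := (Gamma (2^-1 + 1))^-1; set e := 2 ^+ l in e0 *.
set s := steiner_coef _ _; set g := Gamma a; set w := pi `^ _; set z := t ^+ _.
rewrite exprM; set x := _ ^+ l.
clearbody a b c u v e s g w x z.
by field; rewrite e0 G0 p0 a0.
Qed.

(** Each step strips the last two flat dimensions and raises the index [p] by 2. *)
Lemma weyl_pad (R : realType) m m' p h (K : set 'rV[R]_m) (t : R) :
  compact K -> (m' = m + h.*2)%N ->
  omega R p * t ^+ p * (weyl_poly (@pad R m m' @` K) p).[t] =
  omega R (p + h.*2) * t ^+ (p + h.*2) * (weyl_poly K (p + h.*2)).[t].
Proof.
elim: h m' p => [|h IH] m' p cK m'E.
  have {}m'E : m' = m by rewrite m'E addn0.
  subst m'; rewrite addn0 (_ : _ @` K = K)// -[RHS](image_id K).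
  by apply: eq_imagel => x _; rewrite pad_id.
have -> : @pad R m m' @` K = @pad R (m + h.*2) m' @` (@pad R m (m + h.*2) @` K).
  by rewrite image_comp; apply: eq_imagel => x _ /=; rewrite pad_pad// leq_addr.
rewrite weyl_pad2; [|exact: compact_pad|by lia].
have -> : (p + h.+1.*2 = p.+2 + h.*2)%N by lia.
exact: IH.
Qed.

Theorem lemma11p12 (R : realType) (n : nat) (V : set 'rV[R]_n)
    (Vcompact : compact V)
    (Vconvex : convex_set (V : set (convex_lmodType 'rV[R]_n)))
    (Vinterior : V° !=set0)
    (p q : nat) (p_gt0 : (0 < p)%N) (q_gt0 : (0 < q)%N) :
  (~~ odd q -> forall t : R,
     omega R p * t ^+ p * (weyl_poly (prod0 q V) p).[t] =
     omega R (p + q) * t ^+ (p + q) * (weyl_poly V (p + q)).[t]) /\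
  (odd q -> forall t : R,
     omega R p * t ^+ p * (weyl_poly (prod0 q V) p).[t] =
     omega R (p + q - 1) * t ^+ (p + q - 1) *
       (weyl_poly (prod0 1 V) (p + q - 1)).[t]).
Proof.
split=> oq t; rewrite -(odd_double_half q) ?oq ?(negbTE oq) ?add0n ?add1n.
  by rewrite prod0_pad (@weyl_pad _ _ _ _ q./2).
move: (q./2) => h {q oq q_gt0}.
rewrite (_ : (p + h.*2.+1 - 1 = p + h.*2)%N); last by lia.
(* For odd [q] the body is regarded as [prod0 1 V] padded by an even number of dimensions. *)
have dimE : (n + h.*2.+1 = n + 1 + h.*2)%N by lia.
have cV1 : compact (prod0 1 V) by rewrite prod0_pad; exact: compact_pad.
rewrite -(@weyl_pad _ _ _ p h _ t cV1 dimE) !prod0_pad image_comp.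
congr (_ * (weyl_poly _ _).[_]).
by apply: eq_imagel => x _ /=; rewrite pad_pad// leq_addr.
Qed.
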